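(* Let $X$ and $Y$ be two smooth $n$-dimensional manifolds, with $X$ carrying a Riemannian metric, and let $c:X\times Y\to\mathbb{R}$. Assume that $c$ is continuously differentiable with respect to the first variable (so that $\partial c/\partial x$ exists and is continuous), and that $c$ satisfies the $m$-twist condition locally for some $m\in\mathbb{N}$. If for each $x\in X$ and each real $\alpha\ge 0$ the set $\{y\in Y : |\partial c(x,y)/\partial x|=\alpha\}$ is compact, then $c$ satisfies the generalized-twist condition.
   Context: $|\cdot|$ is the norm on the (co)tangent spaces of $X$ induced by its Riemannian metric. $c$ satisfies the $m$-twist condition locally if $x\mapsto c(x,y)$ is differentiable for all $y\in Y$ and for any $x_0\in X$, $y_0\in Y$ there exists a neighborhood $U$ of $y_0$ such that the set $\{y\in U : \frac{\partial c(x_0,y)}{\partial x}=\frac{\partial c(x_0,y_0)}{\partial x}\}$ has cardinality at most $m$. $c$ satisfies the generalized-twist condition if $x\mapsto c(x,y)$ is differentiable for all $y\in Y$ and for any $x_0\in X$, $y_0\in Y$ the set $\{y\in Y : \frac{\partial c(x_0,y)}{\partial x}=\frac{\partial c(x_0,y_0)}{\partial x}\}$ is finite. *)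

(* Defs.v *)
From HB Require Import structures.
From mathcomp Require Import all_boot all_order all_algebra.
From mathcomp Require Import all_classical all_reals all_analysis.

Set Implicit Arguments.
Unset Strict Implicit.
Unset Printing Implicit Defensive.

Import Order.TTheory GRing.Theory Num.Theory.
Import numFieldNormedType.Exports.

Local Open Scope classical_set_scope.
Local Open Scope ring_scope.

(* Only meaningful for open U. *)
Fixpoint Ck (R : realType) (V W : normedModType R) (k : nat) (U : set V)
    (f : V -> W) : Prop :=
  match k with
  | 0 => forall p, U p -> {for p, continuous f}
  | k.+1 => (forall p, U p -> differentiable f p) /\
            (forall v : V, Ck k U (fun p => 'd f p v))
  end.

Definition smooth_on (R : realType) (V W : normedModType R) (U : set V)
    (f : V -> W) : Prop := forall k, Ck k U f.

(* A homeomorphism from the open set cdom onto an open subset of R^n;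
   cparam is its inverse. Both maps are total, and only their values on cdom
   and on its image matter. *)
Record chart (R : realType) (n : nat) (T : topologicalType) := Chart {
  cdom : set T;
  ccoord :> T -> 'rV[R]_n;
  cparam : 'rV[R]_n -> T;
  cdom_open : open cdom;
  cimg_open : open (ccoord @` cdom);
  ccoordK : forall x, cdom x -> cparam (ccoord x) = x;
  ccoord_continuous : {within cdom, continuous ccoord};
  cparam_continuous : {within ccoord @` cdom, continuous cparam}
}.

Record smoothManifold (R : realType) (n : nat) := SmoothManifold {
  mcarrier :> topologicalType;
  atlas : set (chart R n mcarrier);
  atlas_cover : forall x : mcarrier, exists phi, atlas phi /\ cdom phi x;
  atlas_smooth : forall phi psi, atlas phi -> atlas psi ->
    smooth_on (phi @` (cdom phi `&` cdom psi)) (psi \o cparam phi);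
  manifold_hausdorff : hausdorff_space mcarrier;
  manifold_second_countable : @second_countable mcarrier
}.

Section TangentSpace.
Context (R : realType) (n : nat) (M : smoothManifold R n).

Definition chart_at (x : M) (phi : chart R n M) : Prop :=
  atlas phi /\ cdom phi x.

(* A tangent vector at x is given by its components in all charts around x,
   which transform under the Jacobians of the coordinate changes; the value 0
   on the other charts is a normalization. *)
Definition tangent_pred (x : M) : pred (chart R n M -> 'rV[R]_n) :=
  fun v => `[< (forall phi psi, chart_at x phi -> chart_at x psi ->
                  v psi = 'd (psi \o cparam phi) (phi x) (v phi)) /\
               (forall phi, ~ chart_at x phi -> v phi = 0) >].

Lemma tangent_submod_closed (x : M) : submod_closed (tangent_pred x).
Proof.
split=> [|a u v /asboolP[uJ u0] /asboolP[vJ v0]]; apply/asboolP.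
  by split=> // phi psi _ _; rewrite linear0.
split=> [phi psi hphi hpsi|phi hphi].
  by rewrite !fctE (uJ phi psi) // (vJ phi psi) // linearP.
by rewrite !fctE u0 // v0 // scaler0 addr0.
Qed.

HB.instance Definition _ (x : M) := GRing.isSubmodClosed.Build R
  (chart R n M -> 'rV[R]_n) (tangent_pred x) (tangent_submod_closed x).

Record tangent (x : M) := Tangent {
  components :> chart R n M -> 'rV[R]_n;
  _ : tangent_pred x components
}.

HB.instance Definition _ (x : M) := [isSub for @components x].
HB.instance Definition _ (x : M) := [Choice of tangent x by <:].
HB.instance Definition _ (x : M) :=
  [SubChoice_isSubLmodule of tangent x by <:].

Definition cotangent (x : M) := {scalar tangent x}.

Definition mdifferentiable (f : M -> R) (x : M) : Prop :=
  forall phi, chart_at x phi -> differentiable (f \o cparam phi) (phi x).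

Definition some_chart_at (x : M) : chart R n M := projT1 (cid (atlas_cover x)).

(* The chart used here is irrelevant when f is differentiable at x, see
   mdiffE below. *)
Definition mdiff_fun (f : M -> R) (x : M) (v : tangent x) : R :=
  let phi := some_chart_at x in 'd (f \o cparam phi) (phi x) (v phi).

Lemma mdiff_fun_is_linear (f : M -> R) (x : M) :
  scalar (@mdiff_fun f x).
Proof. by move=> a u v; rewrite /mdiff_fun /= linearP. Qed.

HB.instance Definition _ (f : M -> R) (x : M) :=
  GRing.isLinear.Build R (tangent x) R *%R (@mdiff_fun f x)
    (@mdiff_fun_is_linear f x).

Definition mdiff (f : M -> R) (x : M) : cotangent x := @mdiff_fun f x.

End TangentSpace.

Section TangentSpaceFacts.
Context (R : realType) (n : nat) (M : smoothManifold R n).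

Lemma some_chart_atP (x : M) : chart_at x (some_chart_at x).
Proof. exact: (projT2 (cid (atlas_cover x))). Qed.

Lemma differentiable_transition (x : M) (phi psi : chart R n M) :
  chart_at x phi -> chart_at x psi ->
  differentiable (psi \o cparam phi) (phi x).
Proof.
move=> [aphi dphi] [apsi dpsi].
by have [+ _] := atlas_smooth aphi apsi 1; apply; exists x.
Qed.

Lemma near_cparam (x : M) (phi psi : chart R n M) :
  chart_at x phi -> chart_at x psi ->
  \forall p \near phi x, cdom psi (cparam phi p).
Proof.
move=> [_ dphi] [_ dpsi].
have := @cparam_continuous _ _ _ phi.
rewrite (continuous_open_subspace _ (@cimg_open _ _ _ phi)) => /(_ (phi x)).
rewrite inE => /(_ (ex_intro2 _ _ x dphi erefl)); apply.
by rewrite ccoordK//; apply: open_nbhs_nbhs; split => //; exact: cdom_open.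
Qed.

Lemma chart_change (W : normedModType R) (h : M -> W) (x : M)
    (phi psi : chart R n M) (w : 'rV[R]_n) :
  chart_at x phi -> chart_at x psi ->
  differentiable (h \o cparam phi) (phi x) ->
  differentiable (h \o cparam psi) (psi x) ->
  'd (h \o cparam phi) (phi x) w =
  'd (h \o cparam psi) (psi x) ('d (psi \o cparam phi) (phi x) w).
Proof.
move=> hphi hpsi dh1 dh2; have dT := differentiable_transition hphi hpsi.
have eT : (psi \o cparam phi) (phi x) = psi x by rewrite /= ccoordK//; case: hphi.
have := @near_eq_derive R _ W (h \o cparam phi)
  ((h \o cparam psi) \o (psi \o cparam phi)) (phi x) w.
have dh2' : differentiable (h \o cparam psi) ((psi \o cparam phi) (phi x)).
  by rewrite eT.
rewrite (deriveE w dh1) (deriveE w (differentiable_comp dT dh2')).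
have := congr1 (fun F : 'rV[R]_n -> W => F w) (diff_comp dT dh2').
rewrite eT => dE near_dE; refine (etrans (near_dE _) dE).
by apply: filterS (near_cparam hphi hpsi) => p dp /=; rewrite ccoordK.
Qed.

Lemma mdiffE (f : M -> R) (x : M) (phi : chart R n M) (v : tangent x) :
  mdifferentiable f x -> chart_at x phi ->
  mdiff f x v = 'd (f \o cparam phi) (phi x) (v phi).
Proof.
move=> df hphi; have hpsi := some_chart_atP x.
case: v => v vP /=; have [vJ _] := asboolP _ vP.
rewrite /mdiff /mdiff_fun /= (vJ _ _ hphi hpsi) -chart_change//; exact: df.
Qed.

Lemma tangent_existence (x : M) (phi : chart R n M) (w : 'rV[R]_n) :
  chart_at x phi -> exists v : tangent x, v phi = w.
Proof.
move=> hphi.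
pose v := fun psi => if `[< chart_at x psi >]
  then 'd (psi \o cparam phi) (phi x) w else 0.
have vP : tangent_pred x v.
  apply/asboolP; split=> [psi1 psi2 h1 h2|psi h]; rewrite /v; last first.
    by rewrite asboolF.
  by rewrite !asboolT//; apply: chart_change => //;
    exact: differentiable_transition.
exists (Tangent vP); rewrite /= /v asboolT//.
have dT := differentiable_transition hphi hphi.
rewrite -(deriveE w dT) -[RHS](@derive_id R _ (phi x) w).
apply: near_eq_derive.
have [_ dx] := hphi; have := @cimg_open _ _ _ phi.
rewrite openE => /(_ (phi x)) /(_ (ex_intro2 _ _ x dx erefl)).
by apply: filterS => _ [z dz <-] /=; rewrite ccoordK.
Qed.

Lemma tangent_inj (x : M) (phi : chart R n M) (u v : tangent x) :
  chart_at x phi -> u phi = v phi -> u = v.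
Proof.
move=> hphi; case: u v => u uP [v vP] /= uv; apply: val_inj => /=.
have [uJ u0] := asboolP _ uP; have [vJ v0] := asboolP _ vP.
apply: funext => psi; have [hpsi|hpsi] := pselect (chart_at x psi).
  by rewrite (uJ _ _ hphi hpsi) (vJ _ _ hphi hpsi) uv.
by rewrite u0 ?v0.
Qed.

End TangentSpaceFacts.

Record riemannianMetric (R : realType) (n : nat) (M : smoothManifold R n) :=
  RiemannianMetric {
  metric :> forall x : M, tangent x -> tangent x -> R;
  metric_linear : forall (x : M) (v : tangent x), scalar (fun u => metric u v);
  metric_sym : forall (x : M) (u v : tangent x), metric u v = metric v u;
  metric_pos : forall (x : M) (v : tangent x), v != 0 -> 0 < metric v v;
  metric_smooth : forall phi, atlas phi ->
    exists2 G : 'rV[R]_n -> 'M[R]_n, smooth_on (phi @` cdom phi) G &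
    forall x : M, cdom phi x -> forall u v : tangent x,
      metric u v = (u phi *m G (phi x) *m (v phi)^T) 0 0
}.

Section RiemannianNorms.
Context (R : realType) (n : nat) (M : smoothManifold R n).
Variable g : riemannianMetric M.

Definition tangent_norm (x : M) (v : tangent x) : R := Num.sqrt (g x v v).

Definition cotangent_norm (x : M) (xi : cotangent x) : R :=
  sup [set `|xi v| | v in [set v : tangent x | tangent_norm v <= 1]].

End RiemannianNorms.

Section TwistConditions.
Context (R : realType) (n : nat) (X Y : smoothManifold R n).
Implicit Types (c : X -> Y -> R).

Definition dcdx c (x : X) (y : Y) : cotangent x := mdiff (c^~ y) x.

Definition differentiable_fst c : Prop :=
  forall (y : Y) (x : X), mdifferentiable (c^~ y) x.

(* Continuity of the partial differential as a map from X * Y to the cotangent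
   bundle of X, read in the local trivializations given by the charts of X. *)
Definition C1_fst c : Prop :=
  differentiable_fst c /\
  forall phi : chart R n X, atlas phi -> forall w : 'rV[R]_n,
    {within cdom phi `*` [set: Y],
      continuous (fun p : X * Y => 'd ((c^~ p.2) \o cparam phi) (phi p.1) w)}.

Definition locally_m_twist (m : nat) c : Prop :=
  differentiable_fst c /\
  forall (x0 : X) (y0 : Y), exists2 U : set Y, nbhs y0 U &
    ([set y | U y /\ dcdx c x0 y = dcdx c x0 y0] #<= `I_m)%card.

Definition generalized_twist c : Prop :=
  differentiable_fst c /\
  forall (x0 : X) (y0 : Y),
    finite_set [set y : Y | dcdx c x0 y = dcdx c x0 y0].

End TwistConditions.

(* Main.v *)
Require Import Defs.
From HB Require Import structures.
From mathcomp Require Import all_boot all_order all_algebra.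
From mathcomp Require Import all_classical all_reals all_analysis.
Local Open Scope classical_set_scope.
Local Open Scope ring_scope.
Import Order.TTheory GRing.Theory Num.Theory.
Import numFieldNormedType.Exports.

(** Fix [x0] and [y0]. The fibre of [dcdx c x0] through [y0] is closed because the partial
    differential is continuous in [y] ([dcdx_fiber_closed]). It lies in one level set of the norm,
    so it is compact. The local twist condition at each of its points gives a neighbourhood meeting
    it in at most [m] points, and a compact, locally finite set is finite
    ([compact_locally_finite]). *)

(* If A were infinite, a cluster point of its cofinite filter would have no
   neighbourhood meeting A in a finite set. *)
Lemma compact_locally_finite (T : topologicalType) (A : set T) :
  compact A ->
  (forall x, A x -> exists2 U, nbhs x U & finite_set (A `&` U)) ->
  finite_set A.
Proof.
move=> cA fA; apply: contrapT => infA.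
pose F : set_system T := [set B | finite_set (A `\` B)].
have FF : ProperFilter F.
  split; first by rewrite /F /= setD0.
  split=> [|B C FB FC|B C BC].
  - by rewrite /F /= setDT; exact: finite_set0.
  - by rewrite /F /= setDIr finite_setU; split.
  - by rewrite /F /=; apply: sub_finite_set => x [Ax nCx]; split=> // /BC.
have FA : F A by rewrite /F /= setDv; exact: finite_set0.
have [x [Ax clx]] := cA F FF FA.
have [U xU fU] := fA x Ax.
have FU : F (~` U) by rewrite /F /= setDE setCK.
by have [y [nUy Uy]] := clx _ _ FU xU.
Qed.

(** A covector is a function packed with proofs of linearity, which proof irrelevance identifies. *)
Lemma cotangent_ext (R : realType) (n : nat) (M : smoothManifold R n) (x : M)
    (xi eta : cotangent x) : (forall v, xi v = eta v) -> xi = eta.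
Proof.
case: xi eta => f hf [f' hf'] /= /funext ff'.
case: _ / ff' in hf' *; congr (GRing.Linear.Pack _).
case: hf hf' => [[a1] [b1]] [[a2] [b2]].
by rewrite (Prop_irrelevance a1 a2) (Prop_irrelevance b1 b2).
Qed.

Lemma cotangent_norm_ge0 (R : realType) (n : nat) (M : smoothManifold R n)
    (g : riemannianMetric M) (x : M) (xi : cotangent x) :
  0 <= cotangent_norm g xi.
Proof.
rewrite /cotangent_norm; set E := [set _ | _ in _].
(* [sup] is 0 by default on a set without a supremum. *)
have [supE|/sup_out->//] := pselect (has_sup E).
have [[_ [v nv _]] ubE] := supE.
apply: (le_trans (normr_ge0 (xi v))).
by apply: (ub_le_sup ubE); exists v.
Qed.

Lemma dcdx_continuous (R : realType) (n : nat) (X Y : smoothManifold R n)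
    (c : X -> Y -> R) (x : X) (v : tangent x) :
  C1_fst c -> continuous (fun y => dcdx c x y v).
Proof.
move=> [_ cc] y; have [aphi dphi] := some_chart_atP x.
have := cc _ aphi (v (some_chart_at x)).
have oD : open (cdom (some_chart_at x) `*` [set: Y]).
  rewrite openE => -[x1 y1] [/= dx1 _].
  exists (cdom (some_chart_at x), setT) => //; split => /=; last exact: filterT.
  by apply: open_nbhs_nbhs; split => //; exact: cdom_open.
rewrite (continuous_open_subspace _ oD) => /(_ (x, y)).
rewrite inE => /(_ (conj dphi I)) cxy.
(* [mdiff] is computed in [some_chart_at x], so the goal is by definition the map of [C1_fst]
   restricted to the slice through [x]. *)
apply: (@cvg_comp _ _ _ (fun y' : Y => (x, y')) _ _ _ _ _ cxy).
by apply: cvg_pair; [exact: cvg_cst|exact: cvg_id].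
Qed.

(** Testing equality of covectors on each tangent vector avoids a topology on the cotangent space:
    the fibre is an intersection of closed level sets of real functions. *)
Lemma dcdx_fiber_closed (R : realType) (n : nat) (X Y : smoothManifold R n)
    (c : X -> Y -> R) (x : X) (xi : cotangent x) :
  C1_fst c -> closed [set y | dcdx c x y = xi].
Proof.
move=> hC1.
have -> : [set y | dcdx c x y = xi] =
    \bigcap_(v in setT) (fun y => dcdx c x y v) @^-1` [set r | r = xi v].
  apply/seteqP; split=> [y /= <- //|y /= h].
  by apply: cotangent_ext => v; exact: h.
apply: closed_bigI => v _.
by apply: preimage_closed; [move=> y _; exact: dcdx_continuous|exact: closed_eq].
Qed.

Theorem proposition1p1 (R : realType) (n : nat) (X Y : smoothManifold R n)
    (g : riemannianMetric X) (c : X -> Y -> R) (m : nat)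
    (hC1 : C1_fst c)
    (htwist : locally_m_twist m c)
    (hcompact : forall (x : X) (alpha : R), 0 <= alpha ->
       compact [set y : Y | cotangent_norm g (dcdx c x y) = alpha]) :
  generalized_twist c.
Proof.
have [dc twist] := htwist; split=> // x0 y0.
apply: compact_locally_finite => [|y /= yE].
  apply: (subclosed_compact (dcdx_fiber_closed _ _ _ _ _ _ _ hC1)
    (hcompact x0 _ (cotangent_norm_ge0 _ _ _ g _ (dcdx c x0 y0)))).
  by move=> y /= ->.
have [U yU cardU] := twist x0 y; exists U => //.
(* As [y] lies on the fibre through [y0], the twist condition centred at [y] bounds that same fibre
   inside [U]. *)
have -> : [set y' | dcdx c x0 y' = dcdx c x0 y0] `&` U =
    [set y' | U y' /\ dcdx c x0 y' = dcdx c x0 y].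
  by rewrite yE setIC.
exact: card_le_finite cardU (finite_II m).
Qed.
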